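(* Let $n\ge 3$ and $2\le\Delta\le n-1$ be integers. If there is a deterministic single-round algorithm in the CONGEST$(B)$ model that solves the triangle membership problem on all $n$-node graphs of maximum degree at most $\Delta$, then $$B \;\geq\; \log\left(\left(\frac{n-2}{2(\Delta-1)}\right)^{\Delta-1}\right).$$
   Context: CONGEST$(B)$ model (with $KT_1$ knowledge): the network is a simple undirected graph on $n$ nodes, each node having a unique ID in $[N]=\{1,\dots,N\}$, where $N\ge n$ is some polynomial in $n$. Initially each node knows its own ID and the IDs of its neighbors (and the global parameters such as $n$, $\Delta$, $N$), and nothing else about the graph. Computation proceeds in synchronous rounds; in each round each node sends a message of exactly $B$ bits to each of its neighbors (possibly different messages to different neighbors). The message sent in a round is a function of the initial knowledge of the node and the messages received in previous rounds; local computation is unbounded. After the last round each node produces an output determined by its initial knowledge and all messages it received. A deterministic single-round algorithm uses exactly one round of communication. An algorithm solves a problem on a class of graphs if it is correct for every graph in the class and every assignment of distinct IDs from $[N]$. Triangle membership problem: each node must output whether it is contained in a triangle of the graph. Logarithms are base 2. *)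

(* Defs.v *)
From mathcomp Require Import all_boot all_order all_algebra.
From mathcomp Require Import all_classical all_reals all_analysis.

Set Implicit Arguments.
Unset Strict Implicit.
Unset Printing Implicit Defensive.

Import Order.TTheory GRing.Theory Num.Theory.

Record sgraph (n : nat) := SGraph {
  adj : rel 'I_n;
  adj_sym : symmetric adj;
  adj_irr : irreflexive adj
}.

Section Graph.
Variables (n : nat) (G : sgraph n).

Definition nbhd (v : 'I_n) : {set 'I_n} := [set u | adj G v u].

Definition max_degree : nat := \max_(v < n) #|nbhd v|.

Definition in_triangle (v : 'I_n) : bool :=
  [exists u, exists w, [&& adj G v u, adj G v w & adj G u w]].

End Graph.

(* The ID space {1, .., N} is represented by 'I_N, the element i standing for
   the ID i + 1. *)

Definition message (B : nat) := B.-tuple bool.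

(* KT_1: a node's own ID and the set of IDs of its neighbors.  Global
   parameters (n, the degree bound, N) are fixed before the algorithm, which
   may therefore depend on them. *)
Definition knowledge (N : nat) := ('I_N * {set 'I_N})%type.

(* What a node receives in one round: the value at an ID i is [Some m] if the
   neighbor with ID i sent m, and [None] if no neighbor has ID i. *)
Definition inbox (N B : nat) := {ffun 'I_N -> option (message B)}.

(* Deterministic CONGEST(B) algorithm with outputs in O.  The list of inboxes
   of all previous rounds (oldest first) also tells the node the current round
   number; the last argument of [send] is the ID of the recipient. *)
Record algorithm (N B : nat) (O : Type) := Algorithm {
  rounds : nat;
  send : knowledge N -> seq (inbox N B) -> 'I_N -> message B;
  output : knowledge N -> seq (inbox N B) -> O
}.

Section Execution.
Variables (N B : nat) (O : Type) (A : algorithm N B O).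
Variables (n : nat) (G : sgraph n) (id : 'I_n -> 'I_N).

Definition initial_knowledge (v : 'I_n) : knowledge N :=
  (id v, [set id u | u in nbhd G v]).

Fixpoint received (t : nat) : 'I_n -> seq (inbox N B) :=
  if t is t'.+1 then
    fun v => rcons (received t' v)
      [ffun i => omap
         (fun u => send A (initial_knowledge u) (received t' u) (id v))
         [pick u in nbhd G v | id u == i]]
  else fun _ => [::].

Definition run (v : 'I_n) : O :=
  output A (initial_knowledge v) (received (rounds A) v).

End Execution.

Definition solves_triangle_membership (n Delta N B : nat)
    (A : algorithm N B bool) : Prop :=
  forall G : sgraph n, (max_degree G <= Delta)%N ->
  forall id : 'I_n -> 'I_N, injective id ->
  forall v : 'I_n, run A G id v = in_triangle G v.

Definition log2 (R : realType) (x : R) : R := (ln x / ln 2)%R.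

(* Main.v *)
Require Import Defs.
From mathcomp Require Import all_boot all_order all_algebra.
From mathcomp Require Import all_classical all_reals all_analysis.
From mathcomp Require Import zify.

(** Fix a node [v].  For a neighbor [u] of [v], let [S] be the set of the other
    neighbors of [u]; the message of [u] to [v] depends only on [S].  Let [D u]
    be the set of nodes [w] such that this message determines whether [w] is in
    [S].  If neither [w] is in [D u] nor [u] in [D w], then a node [v] with
    neighbors [u] and [w] cannot tell whether [u] and [w] are adjacent, that is,
    whether it lies in a triangle.  Hence the sets [D u] contain one element of
    each of the pairs of the [n - 1] nodes other than [v], and by averaging some
    [D u] has size [k >= (n - 2) / 2].  The message of [u] then distinguishes
    all the [(Delta - 1)]-subsets of [D u], so that, if [k >= Delta - 1],
    [2 ^ B >= 'C(k, Delta - 1) >= (k / (Delta - 1)) ^ (Delta - 1)];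
    if [k < Delta - 1], the bound on [B] is nonpositive. *)

Set Implicit Arguments.
Unset Strict Implicit.

Import Order.TTheory GRing.Theory Num.Theory.

Lemma run_one_round (n N B : nat) (O : Type) (A : algorithm N B O)
    (G G' : sgraph n) (id : 'I_n -> 'I_N) (v : 'I_n) :
  rounds A = 1 -> nbhd G v = nbhd G' v ->
  (forall u, u \in nbhd G v ->
     send A (initial_knowledge G id u) [::] (id v) =
     send A (initial_knowledge G' id u) [::] (id v)) ->
  run A G id v = run A G' id v.
Proof.
move=> A1 eqN eqm; rewrite /run A1 /= /initial_knowledge eqN.
congr (output _ _ [:: _]); apply/ffunP=> i; rewrite !ffunE -eqN.
by case: pickP => //= u /andP[uv _]; rewrite eqm.
Qed.

Section FoolingGraph.
Variables (n : nat) (v u w : 'I_n) (S T : {set 'I_n}).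
Hypotheses (uv : u != v) (wv : w != v) (uw : u != w).
Hypotheses (vS : v \notin S) (uS : u \notin S).
Hypotheses (vT : v \notin T) (wT : w \notin T).
Hypothesis ST : (w \in S) = (u \in T).

(** Arcs leaving [v], [u] and [w], made symmetric below. By [ST] both ends agree on the edge between
    [u] and [w], so that symmetrizing adds nothing but [v] to the neighborhoods [S] of [u] and [T]
    of [w]. *)
Definition fooling_edge : rel 'I_n := fun a b =>
  [|| (a == v) && (b \in [set u; w]), (a == u) && (b \in S)
    | (a == w) && (b \in T)].

Definition fooling_adj : rel 'I_n := fun a b =>
  fooling_edge a b || fooling_edge b a.

Lemma fooling_adj_sym : symmetric fooling_adj.
Proof. by move=> a b; rewrite /fooling_adj orbC. Qed.

Lemma fooling_adj_irr : irreflexive fooling_adj.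
Proof.
move=> a; rewrite /fooling_adj orbb /fooling_edge !inE.
case: (eqVneq a v) => [->|_] /=.
  by rewrite !(eq_sym v) !(negPf uv, negPf wv).
case: (eqVneq a u) => [->|_] /=; first by rewrite (negPf uS) (negPf uw).
by case: (eqVneq a w) => [->|_] //=; rewrite (negPf wT).
Qed.

Definition fooling_graph := SGraph fooling_adj_sym fooling_adj_irr.

Lemma nbhd_fooling_center : nbhd fooling_graph v = [set u; w].
Proof.
apply/setP=> b; rewrite !inE /= /fooling_adj /fooling_edge !inE eqxx /=.
rewrite (negPf vS) (negPf vT) !(eq_sym v) (negPf uv) (negPf wv) !andbF !orbF.
by [].
Qed.

Lemma nbhd_fooling_l : nbhd fooling_graph u = v |: S.
Proof.
apply/setP=> b; rewrite !inE /= /fooling_adj /fooling_edge !inE eqxx /=.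
rewrite (negPf uv) (negPf uw) (negPf uS) -ST /= andbF andbT orbF /=.
by case: (eqVneq b w) => [->|_]; rewrite ?andbF ?orbF ?andbT /=;
  case: (_ == v); case: (_ \in S).
Qed.

Lemma nbhd_fooling_r : nbhd fooling_graph w = v |: T.
Proof.
apply/setP=> b; rewrite !inE /= /fooling_adj /fooling_edge !inE eqxx /=.
rewrite (negPf wv) (eq_sym w u) (negPf uw) (negPf wT) ST /= andbF orbF andbT /=.
by case: (eqVneq b u) => [->|_]; rewrite ?andbF ?orbF ?andbT /=;
  case: (_ == v); case: (_ \in T).
Qed.

Lemma nbhd_fooling_other x :
  x != v -> x != u -> x != w -> nbhd fooling_graph x \subset [set u; w].
Proof.
move=> xv xu xw; apply/fintype.subsetP=> b.
rewrite !inE /= /fooling_adj /fooling_edge !inE.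
rewrite (negPf xv) (negPf xu) (negPf xw) /= andbF /=.
by case: (b == u); case: (b == w).
Qed.

Lemma in_triangle_fooling : in_triangle fooling_graph v = (w \in S).
Proof.
have adjE a b : adj fooling_graph a b = (b \in nbhd fooling_graph a).
  by rewrite inE.
have wSE : adj fooling_graph u w = (w \in S).
  by rewrite adjE nbhd_fooling_l !inE (negPf wv).
apply/existsP/idP => [[a /existsP[b /and3P[]]]|wS].
  rewrite !adjE nbhd_fooling_center !inE.
  move=> /orP[]/eqP-> /orP[]/eqP->.
  - by rewrite adj_irr.
  - by rewrite wSE.
  - by rewrite adj_sym wSE.
  - by rewrite adj_irr.
exists u; apply/existsP; exists w.
by rewrite wSE wS !adjE nbhd_fooling_center !inE !eqxx orbT.
Qed.

(** The bound 2 covers [v] and every node outside [v], [u], [w], whose neighbors lie in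
    [[set u; w]]; the strict bounds on [S] and [T] leave room for [v]. *)
Lemma max_degree_fooling Delta :
  2 <= Delta -> #|S| < Delta -> #|T| < Delta ->
  max_degree fooling_graph <= Delta.
Proof.
move=> D2 cS cT; apply/bigmax_leqP => x _.
have [->|xv] := eqVneq x v; first by rewrite nbhd_fooling_center cards2 uw.
have [->|xu] := eqVneq x u; first by rewrite nbhd_fooling_l cardsU1 vS.
have [->|xw] := eqVneq x w; first by rewrite nbhd_fooling_r cardsU1 vT.
have := subset_leq_card (nbhd_fooling_other xv xu xw).
by rewrite cards2 uw => /leq_trans; apply.
Qed.

End FoolingGraph.

Section Determined.
Variables (n N B Delta : nat) (A : algorithm N B bool) (id : 'I_n -> 'I_N).
Variable v : 'I_n.

Definition first_message (u : 'I_n) (S : {set 'I_n}) : message B :=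
  send A (id u, [set id x | x in v |: S]) [::] (id v).

Definition other_nbrs (u : 'I_n) (S : {set 'I_n}) : bool :=
  [&& v \notin S, u \notin S & #|S| < Delta].

Definition determines (u w : 'I_n) : bool :=
  [forall S, forall S', [&& other_nbrs u S, other_nbrs u S'
     & first_message u S == first_message u S'] ==> ((w \in S) == (w \in S'))].

Lemma determinesPn u w : ~~ determines u w ->
  exists S S', [/\ other_nbrs u S, other_nbrs u S',
    first_message u S = first_message u S', w \in S & w \notin S'].
Proof.
case/forallPn=> S /forallPn[S']; rewrite negb_imply.
move=> /andP[/and3P[oS oS' /eqP e]].
case wS: (w \in S); case wS': (w \in S') => // _.
  by exists S, S'; rewrite wS'.
by exists S', S; rewrite wS.
Qed.

Lemma determines_total u w :
  2 <= Delta -> rounds A = 1 -> injective id ->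
  solves_triangle_membership n Delta A ->
  u != v -> w != v -> u != w -> determines u w || determines w u.
Proof.
move=> D2 A1 id_inj solA uv wv uw; apply: contraT; rewrite negb_or => /andP[].
move=> /determinesPn[S [S' [/and3P[vS uS cS] /and3P[vS' uS' cS'] eS wS wS']]].
move=> /determinesPn[T [T' [/and3P[vT wT cT] /and3P[vT' wT' cT'] eT uT uT']]].
(* The four sets are paired so that [S], [T] both assert the edge between [u] and [w] and [S'], [T']
   both deny it: each pair is consistent and gives a graph, and [v] receives the same messages in
   the two graphs. *)
have ST : (w \in S) = (u \in T) by rewrite wS uT.
have ST' : (w \in S') = (u \in T') by rewrite (negPf wS') (negPf uT').
pose G := fooling_graph uv wv uw uS wT.
pose G' := fooling_graph uv wv uw uS' wT'.
have: run A G id v = run A G' id v.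
  apply: run_one_round => // [|x]; rewrite !nbhd_fooling_center //.
  by rewrite !inE /initial_knowledge => /orP[]/eqP->;
    rewrite ?nbhd_fooling_l ?nbhd_fooling_r.
rewrite !solA ?max_degree_fooling // !in_triangle_fooling //.
by rewrite wS (negPf wS').
Qed.

Lemma card_determined u (D : {set 'I_n}) :
  0 < Delta -> v \notin D -> u \notin D -> {in D, forall w, determines u w} ->
  'C(#|D|, Delta.-1) <= 2 ^ B.
Proof.
move=> D0 vD uD Ddet; rewrite -cards_draws.
have oS (S : {set 'I_n}) : S \subset D -> #|S| == Delta.-1 -> other_nbrs u S.
  move=> /fintype.subsetP SD /eqP cS.
  rewrite /other_nbrs cS prednK // leqnn andbT.
  by rewrite (contra (SD v)) // (contra (SD u)).
(* It suffices that [first_message u] is injective on the subsets of [D] of size [Delta.-1]: equal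
   messages force agreement on [D], and outside [D] both subsets are empty. *)
rewrite -(card_in_imset (f := first_message u)).
  by rewrite (leq_trans (max_card _)) // card_tuple card_bool.
move=> S S'; rewrite !inE => /andP[SD cS] /andP[SD' cS'] e; apply/setP=> w.
have [wD|wD] := boolP (w \in D); last first.
  have wS := contra (fintype.subsetP SD w) wD.
  by rewrite (negPf wS) (negPf (contra (fintype.subsetP SD' w) wD)).
have /forallP/(_ S)/forallP/(_ S')/implyP := Ddet w wD.
by rewrite !oS // e eqxx => /(_ isT)/eqP.
Qed.

End Determined.

(** Out-degree plus in-degree is at least [#|A|.-1] at every vertex, and both degrees have the same
    total, so the average out-degree is at least half of [#|A|.-1]. *)
Lemma semicomplete_outdegree (T : finType) (A : {set T}) (r : rel T) :
  0 < #|A| -> {in A &, forall x y, x != y -> r x y || r y x} ->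
  exists2 x, x \in A & #|A|.-1 <= 2 * #|[set y in A :\ x | r x y]|.
Proof.
move=> A0 rA; apply/exists_inP; apply: contraT => /exists_inPn small.
pose s x := \sum_(y in A :\ x) r x y.
have sE x : #|[set y in A :\ x | r x y]| = s x.
  rewrite /s -sum1dep_card big_mkcondr /=.
  by apply: eq_bigr => y _; case: (r x y).
have lt_s : \sum_(x in A) 2 * s x < #|A| * #|A|.-1.
  (* Each vertex falls short by at least 1, which gives a total slack of [#|A|], positive by
     [A0]. *)
  apply: (@leq_trans (\sum_(x in A) 2 * s x + #|A|)).
    by rewrite -addn1 leq_add2l.
  rewrite -[X in _ + X]sum1_card -big_split -sum_nat_const /=.
  by apply: leq_sum => x xA; rewrite addn1 -sE ltnNge small.
suff : #|A| * #|A|.-1 <= \sum_(x in A) 2 * s x by rewrite leqNgt lt_s.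
(* Total out-degree equals total in-degree. *)
have sC : \sum_(x in A) s x = \sum_(x in A) \sum_(y in A :\ x) r y x.
  rewrite /s (exchange_big_dep (mem A)) /= => [|x y xA]; last first.
    by rewrite !inE => /andP[].
  apply: eq_bigr => x xA; apply: eq_bigl => y.
  by rewrite !inE xA eq_sym andbT andbC.
rewrite -big_distrr /= mul2n -addnn {2}sC -big_split -sum_nat_const /=.
apply: leq_sum => x xA; rewrite /s -big_split /= [#|A|](cardsD1 x) xA /=.
rewrite -sum1_card; apply: leq_sum => y; rewrite !inE => /andP[yx yA].
have := rA x y xA yA; rewrite eq_sym => /(_ yx).
by case: (r x y); case: (r y x).
Qed.

Lemma expn_leq_bin (k d : nat) : d <= k -> k ^ d <= 'C(k, d) * d ^ d.
Proof.
move=> dk; rewrite -(leq_pmul2r (fact_gt0 d)) mulnAC bin_ffact.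
(* Compared factor by factor: [k * (d - j) <= (k - j) * d] because [d <= k]. *)
suff ind j : k ^ j * d ^_ j <= k ^_ j * d ^ j by have := ind d; rewrite ffactnn.
elim: j => // j IH; rewrite !ffactnSr !expnSr mulnACA [leqRHS]mulnACA.
by rewrite leq_mul // mulnBr mulnBl leq_sub2l // mulnC leq_mul2r dk orbT.
Qed.

Local Open Scope ring_scope.

Lemma log2_le_nat (R : realType) (x : R) (B : nat) :
  x <= 2 ^+ B -> log2 x <= B%:R.
Proof.
move=> xB; have ln2_gt0 : 0 < ln (2 : R) by rewrite ln_gt0 ?ltr1n.
rewrite /log2 ler_pdivrMr //.
(* [ln] is 0 by convention on nonpositive reals. *)
have [x0|x0] := leP x 0; first by rewrite ln0 // mulr_ge0 ?ler0n // ltW.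
by rewrite mulr_natl -lnXn ?ltr0n // ler_ln // posrE exprn_gt0 // ltr0n.
Qed.

Unset Implicit Arguments.

Theorem theorem2 (R : realType) (n Delta N B : nat)
    (hn : (3 <= n)%N) (hDelta2 : (2 <= Delta)%N) (hDelta : (Delta <= n - 1)%N)
    (hN : (n <= N)%N)
    (hA : exists A : algorithm N B bool,
        rounds A = 1%N /\ solves_triangle_membership n Delta A) :
  log2 (((n%:R - 2) / (2 * (Delta%:R - 1))) ^+ (Delta - 1)) <= B%:R :> R.
Proof.
apply: log2_le_nat.
case: hA => A [A1 solA].
pose v : 'I_n := Ordinal (leq_trans (isT : (0 < 3)%N) hn).
have id_inj : injective (widen_ord hN) by move=> i j /(congr1 val)/= /val_inj.
pose det := determines Delta A (widen_ord hN) v.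
have cV : #|[set~ v]| = n.-1 by rewrite cardsC1 card_ord.
have [||u] := @semicomplete_outdegree _ [set~ v] det.
- by rewrite cV; lia.
- move=> x y; rewrite !inE => xv yv xy.
  exact: determines_total.
set D := [set y in _ | _]; rewrite cV => uv leD.
have cD : ('C(#|D|, Delta.-1) <= 2 ^ B)%N.
  apply: (@card_determined n N B Delta A (widen_ord hN) v u D); first by lia.
  - by rewrite !inE eqxx andbF.
  - by rewrite !inE eqxx.
  - by move=> w; rewrite inE => /andP[].
move: cD leD; move: (#|D|) => k cD leD; rewrite -subn1 in cD.
have DeltaE : Delta%:R - 1 = (Delta - 1)%:R :> R by rewrite natrB // ltnW.
have nE : n%:R - 2 = (n - 2)%:R :> R by rewrite natrB // ltnW.
rewrite DeltaE nE -natrM.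
have d0 : (0 < Delta - 1)%N by lia.
move: (Delta - 1)%N d0 cD => d d0 cD {DeltaE nE}.
(* [leD] says that [n - 2 <= 2 * k], since [v] and then [u] are removed from the [n] nodes. *)
have le_kd : (n - 2)%:R / (2 * d)%:R <= k%:R / d%:R :> R.
  rewrite ler_pdivrMr ?ltr0n ?muln_gt0 // natrM mulrCA.
  rewrite divfK ?pnatr_eq0 -?lt0n //.
  by rewrite -natrM ler_nat; lia.
have ge0 : 0 <= (n - 2)%:R / (2 * d)%:R :> R by rewrite divr_ge0 ?ler0n.
(* For [k < d] the binomial coefficient vanishes and [cD] says nothing, but then the base is at most
   1 and so is its power. *)
have [dk|kd] := leqP d k; last first.
  apply: (@le_trans _ _ 1); last by rewrite exprn_ege1 // ler1n.
  apply: exprn_ile1 => //; apply: le_trans le_kd _.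
  by rewrite ler_pdivrMr ?ltr0n // mul1r ler_nat ltnW.
apply: (@le_trans _ _ ((k%:R / d%:R) ^+ d)).
  by rewrite lerXn2r // nnegrE divr_ge0 ?ler0n.
rewrite expr_div_n ler_pdivrMr ?exprn_gt0 ?ltr0n // -!natrX -natrM ler_nat.
by rewrite (leq_trans (expn_leq_bin dk)) // leq_mul2r cD orbT.
Qed.
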